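(* Let $X\in\mathcal{K}_\Lambda=\mathcal{K}^{[-1,0]}(\operatorname{proj}\Lambda)$ and let $M\in\operatorname{mod}\Lambda$, with class $[M]$ in $K_0(\operatorname{mod}\Lambda)$. If $X$ is $M$-semistable, then $X$ is numerically $[M]$-semistable.
   Context: $\Lambda\cong\mathbb{C}Q/I$ is a finite-dimensional $\mathbb{C}$-algebra ($Q$ a finite quiver, $I$ an admissible ideal) and $\operatorname{mod}\Lambda$ is the category of finitely generated $\Lambda$-modules. $\mathcal{K}_\Lambda=\mathcal{K}^{[-1,0]}(\operatorname{proj}\Lambda)$ is the full subcategory of $\mathcal{K}^b(\operatorname{proj}\Lambda)\subset\mathcal{D}^b(\operatorname{mod}\Lambda)$ of complexes of finitely generated projectives concentrated in degrees $-1$ and $0$, $X=(X^{-1}\xrightarrow{x}X^0)$, up to homotopy. A morphism $f:Y\to X$ in $\mathcal{K}_\Lambda$ is an inflation, written $Y\rightarrowtail X$, if it fits into a triangle $Y\xrightarrow{f}X\to Z\to Y[1]$ of $\mathcal{D}^b(\operatorname{mod}\Lambda)$ with $Z\in\mathcal{K}_\Lambda$. $[X]=[X^0]-[X^{-1}]\in K_0(\operatorname{proj}\Lambda)$, and $\langle-,-\rangle:K_0(\operatorname{proj}\Lambda)\times K_0(\operatorname{mod}\Lambda)\to\mathbb{Z}$ is the bilinear Euler form, given by $\langle[X],[M]\rangle=\dim\operatorname{Hom}_\Lambda(X^0,M)-\dim\operatorname{Hom}_\Lambda(X^{-1},M)$. $X$ is $M$-semistable if $x^*:\operatorname{Hom}(X^0,M)\to\operatorname{Hom}(X^{-1},M)$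 is an isomorphism (equivalently, $\langle[X],[M]\rangle=0$ and $\det(x^* )\neq0$; this does not depend on the chosen representative of $X$). For $d\in K_0(\operatorname{mod}\Lambda)$, $X$ is numerically $d$-semistable if (1) $\langle[X],d\rangle=0$, and (2) for every inflation $Y\rightarrowtail X$ in $\mathcal{K}_\Lambda$, $\langle[Y],d\rangle\geq0$. *)

(* Defs.v *)
From HB Require Import structures.
From mathcomp Require Import all_boot all_order all_algebra all_field.
From mathcomp Require Import boolp reals complex freeg.
From mathcomp Require Import zify.

Set Implicit Arguments.
Unset Strict Implicit.
Unset Printing Implicit Defensive.

Import GRing.Theory VectorInternalTheory.
Local Open Scope ring_scope.
Local Open Scope quotient_scope.

Record quiver := Quiver {
  vertex : finType;
  arrow : finType;
  src : arrow -> vertex;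
  tgt : arrow -> vertex }.

Section PathAlgebra.
Variables (F : fieldType) (Q : quiver).

Fixpoint is_path (v : vertex Q) (s : seq (arrow Q)) : bool :=
  if s is a :: s' then (src a == v) && is_path (tgt a) s' else true.

(* A path is its starting vertex together with its consecutive arrows. *)
Definition qpath := {p : vertex Q * seq (arrow Q) | is_path p.1 p.2}.
Definition path_start (p : qpath) : vertex Q := (val p).1.
Definition path_arrows (p : qpath) : seq (arrow Q) := (val p).2.
Definition path_end (p : qpath) : vertex Q :=
  last (path_start p) [seq tgt a | a <- path_arrows p].
Definition trivial_path (v : vertex Q) : qpath := exist _ (v, [::]) isT.

Definition path_algebra := {freeg qpath / F}.

Definition path_mul (p q : qpath) : path_algebra :=
  if path_end p == path_start q then
    if insub (path_start p, path_arrows p ++ path_arrows q) is Some r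
    then << r >> else 0
  else 0.

Definition pa_mul (x y : path_algebra) : path_algebra :=
  \sum_(p <- dom x) \sum_(q <- dom y) (coeff p x * coeff q y) *: path_mul p q.

Definition pa_one : path_algebra := \sum_(v : vertex Q) << trivial_path v >>.

(* The [m]-th power of the arrow ideal. *)
Definition in_arrow_ideal_pow (m : nat) (x : path_algebra) : Prop :=
  forall p, p \in dom x -> (m <= size (path_arrows p))%N.

Definition two_sided_ideal (I : path_algebra -> Prop) : Prop :=
  [/\ I 0,
      forall x y, I x -> I y -> I (x - y),
      forall x y, I y -> I (pa_mul x y) &
      forall x y, I x -> I (pa_mul x y)].

Definition admissible (I : path_algebra -> Prop) : Prop :=
  [/\ two_sided_ideal I,
      forall x, I x -> in_arrow_ideal_pow 2 x &
      exists2 m : nat, (2 <= m)%N & forall x, in_arrow_ideal_pow m x -> I x].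

End PathAlgebra.

(* [L] is isomorphic to [F Q / I]: it is the image of a surjective morphism of
   algebras on [F Q] with kernel [I].  Replacing [Q] by its opposite exchanges
   the two conventions for composing paths, so the choice made in [path_mul]
   is immaterial. *)
Definition bound_quiver_algebra (F : fieldType) (L : falgType F) : Prop :=
  exists (Q : quiver) (I : path_algebra F Q -> Prop)
         (phi : {linear path_algebra F Q -> L}),
    [/\ admissible I,
        phi (pa_one F Q) = 1,
        forall x y, phi (pa_mul x y) = phi x * phi y,
        forall a, exists x, phi x = a &
        forall x, phi x = 0 <-> I x].

Section Modules.
Variables (F : fieldType) (L : falgType F).

Record is_action (V : vectType F) (op : L -> V -> V) : Prop := IsAction {
  op_linl : forall v, linear (op^~ v);
  op_linr : forall a, linear (op a);
  op1 : forall v, op 1 v = v;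
  opM : forall a b v, op (a * b) v = op a (op b v) }.

(* As [L] is finite-dimensional, its finitely generated left modules are the
   finite-dimensional [F]-vector spaces with a linear left action of [L]. *)
Record fdmod := FdMod {
  carrier :> vectType F;
  act : L -> carrier -> carrier;
  actP : is_action act }.

Definition act_linl (M : fdmod) := op_linl (actP M).
Definition act_linr (M : fdmod) := op_linr (actP M).
Definition act1 (M : fdmod) := op1 (actP M).
Definition actM (M : fdmod) := opM (actP M).

HB.instance Definition _ (M : fdmod) (a : L) :=
  GRing.isLinear.Build F M M *:%R (@act M a) (@act_linr M a).

Implicit Types M N P : fdmod.

(* [modhom M N] is the space of [L]-linear maps, see [modhomP]. *)
Definition hom_defect (M N : fdmod) (a : L) (f : 'Hom(M, N)) : 'Hom(M, N) :=
  (f \o linfun (@act M a))%VF - (linfun (@act N a) \o f)%VF.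

Lemma hom_defectE M N a (f : 'Hom(M, N)) v :
  hom_defect a f v = f (act a v) - act a (f v).
Proof. by rewrite /hom_defect add_lfunE opp_lfunE !comp_lfunE !lfunE. Qed.

Lemma hom_defect_linear M N a : linear (@hom_defect M N a).
Proof.
move=> k f g; apply/lfunP => v.
rewrite hom_defectE [RHS]add_lfunE scale_lfunE !hom_defectE !add_lfunE !scale_lfunE.
by rewrite linearD linearZ /= scalerBr opprD addrACA.
Qed.

HB.instance Definition _ M N a :=
  GRing.isLinear.Build F 'Hom(M, N) 'Hom(M, N) *:%R (@hom_defect M N a)
    (@hom_defect_linear M N a).

Definition modhom (M N : fdmod) : {vspace 'Hom(M, N)} :=
  (\bigcap_(i < \dim {:L}) lker (linfun (@hom_defect M N (vbasis {:L})`_i)))%VS.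

Lemma modhomP M N (f : 'Hom(M, N)) :
  f \in modhom M N <-> forall a v, f (act a v) = act a (f v).
Proof.
rewrite memvE; split => [/subv_bigcapP H a v|H]; last first.
  apply/subv_bigcapP => i _; rewrite -memvE memv_ker lfunE; apply/eqP/lfunP => v.
  by rewrite zero_lfunE /= hom_defectE H subrr.
have actE (P : fdmod) (w : P) : act a w =
    \sum_(i < \dim {:L}) coord (vbasis {:L}) i a *: act (vbasis {:L})`_i w.
  pose g := GRing.isLinear.Build F L P *:%R ((@act P)^~ w) (act_linl w).
  pose h : {linear L -> P} := HB.pack ((@act P)^~ w) g.
  rewrite -[act a w]/(h a) {1}(coord_vbasis (memvf a)) linear_sum.
  by apply: eq_bigr => i _; rewrite linearZ.
rewrite !actE linear_sum; apply: eq_bigr => i _; rewrite linearZ; congr (_ *: _).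
have := H i isT; rewrite -memvE memv_ker lfunE => /eqP/lfunP/(_ v).
by rewrite zero_lfunE /= hom_defectE => /eqP; rewrite subr_eq0 => /eqP.
Qed.

Lemma modhom_comp M N P (g : 'Hom(N, P)) (f : 'Hom(M, N)) :
  g \in modhom N P -> f \in modhom M N -> (g \o f)%VF \in modhom M P.
Proof.
move=> /modhomP gh /modhomP fh; apply/modhomP => a v.
by rewrite !comp_lfunE fh gh.
Qed.

Lemma modhom_id M : \1%VF \in modhom M M.
Proof. by apply/modhomP => a v; rewrite !id_lfunE. Qed.

Definition is_zero (M : fdmod) : Prop := forall v : M, v = 0.

Definition projective (P : fdmod) : Prop :=
  forall (M N : fdmod) (g : 'Hom(M, N)) (h : 'Hom(P, N)),
    g \in modhom M N -> h \in modhom P N -> limg g = fullv ->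
    exists2 k : 'Hom(P, M), k \in modhom P M & (g \o k)%VF = h.

Record projmod := ProjMod { proj_mod :> fdmod; projmodP : projective proj_mod }.

Definition short_exact (M' M M'' : fdmod)
    (f : 'Hom(M', M)) (g : 'Hom(M, M'')) : Prop :=
  [/\ f \in modhom M' M, g \in modhom M M'', lker f = 0%VS, limg f = lker g &
      limg g = fullv].

Section DirectSum.
Variables M N : fdmod.

Definition dsum_act (a : L) (v : M * N) : M * N := (act a v.1, act a v.2).

Fact dsum_actP : is_action dsum_act.
Proof.
split=> [v k a b|a k u v|v|a b v]; rewrite /dsum_act /=.
- by rewrite !act_linl.
- by rewrite !act_linr.
- by rewrite !act1; case: v.
- by rewrite !actM.
Qed.

Definition dsum : fdmod := @FdMod (M * N)%type dsum_act dsum_actP.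

End DirectSum.

Section HomExact.
Variables (A B M' M M'' : fdmod).

Definition postcomp (g : 'Hom(M, M'')) (h : 'Hom(A, M)) : 'Hom(A, M'') :=
  (g \o h)%VF.
Fact postcomp_linear g : linear (postcomp g).
Proof. by move=> k u v; rewrite /postcomp comp_lfunDr comp_lfunZr. Qed.
HB.instance Definition _ g :=
  GRing.isLinear.Build F 'Hom(A, M) 'Hom(A, M'') *:%R (postcomp g)
    (@postcomp_linear g).

Definition precomp (g : 'Hom(A, B)) (h : 'Hom(B, M)) : 'Hom(A, M) :=
  (h \o g)%VF.
Fact precomp_linear g : linear (precomp g).
Proof. by move=> k u v; rewrite /precomp comp_lfunDl comp_lfunZl. Qed.
HB.instance Definition _ g :=
  GRing.isLinear.Build F 'Hom(B, M) 'Hom(A, M) *:%R (precomp g)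
    (@precomp_linear g).
End HomExact.

Lemma dim_hom_exactr (P M' M M'' : fdmod) (f : 'Hom(M', M)) (g : 'Hom(M, M'')) :
  projective P -> short_exact f g ->
  \dim (modhom P M) = (\dim (modhom P M') + \dim (modhom P M''))%N.
Proof.
move=> Pproj [fh gh f0 fg gsurj].
pose S := linfun (@postcomp P M' M f); pose T := linfun (@postcomp P M M'' g).
have gf v : g (f v) = 0.
  by apply/eqP; rewrite -memv_ker -fg memv_img // memvf.
have finj := lker0P (introT eqP f0).
rewrite -(limg_ker_dim T (modhom P M)); congr addn.
  rewrite -(@limg_dim_eq _ _ _ S (modhom P M')).
    congr (\dim _); apply/vspaceP => h; rewrite memv_cap.
    apply/andP/memv_imgP => [[hh]|[k kh ->]].
      rewrite memv_ker lfunE /= => /eqP/lfunP gh0.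
      have hf v : f ((f^-1)%VF (h v)) = h v.
        by apply: limg_lfunVK; rewrite fg memv_ker -comp_lfunE gh0 lfunE.
      exists (f^-1 \o h)%VF; last first.
        by rewrite lfunE; apply/lfunP => v; rewrite !comp_lfunE hf.
      apply/modhomP => a v; apply: finj.
      move/modhomP: fh => fh; move/modhomP: hh => hh.
      by rewrite !comp_lfunE fh !hf hh.
    split; first by rewrite lfunE; apply: modhom_comp.
    by rewrite memv_ker !lfunE; apply/eqP/lfunP => v; rewrite !comp_lfunE gf lfunE.
  apply/eqP; rewrite -subv0; apply/subvP => h; rewrite memv_cap memv_ker memv0.
  move=> /andP[_]; rewrite lfunE => /eqP/lfunP fh0; apply/eqP/lfunP => v.
  by apply: finj; rewrite -comp_lfunE fh0 !lfunE linear0.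
congr (\dim _); apply/vspaceP => h; apply/memv_imgP/idP => [[k kh ->]|hh].
  by rewrite lfunE; apply: modhom_comp.
by have [k kh kE] := Pproj _ _ _ _ gh hh gsurj; exists k; rewrite // lfunE.
Qed.

Lemma dim_hom_exactl (P' P P'' M : fdmod) (f : 'Hom(P', P)) (g : 'Hom(P, P'')) :
  projective P'' -> short_exact f g ->
  \dim (modhom P M) = (\dim (modhom P' M) + \dim (modhom P'' M))%N.
Proof.
move=> Pproj [fh gh f0 fg gsurj].
have finj := lker0P (introT eqP f0).
have [s sh gs] := Pproj _ _ _ _ gh (modhom_id P'') gsurj.
have gsE v : g (s v) = v by rewrite -comp_lfunE gs id_lfunE.
have gf v : g (f v) = 0.
  by apply/eqP; rewrite -memv_ker -fg memv_img // memvf.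
pose r := (f^-1 \o (\1 - (s \o g)%VF))%VF.
have frE v : f (r v) = v - s (g v).
  rewrite comp_lfunE limg_lfunVK add_lfunE opp_lfunE comp_lfunE id_lfunE //.
  by rewrite fg memv_ker linearB /= gsE subrr.
have rf v : r (f v) = v by apply: finj; rewrite frE gf linear0 subr0.
have rh : r \in modhom P P'.
  move/modhomP: (fh) => fh'; move/modhomP: (gh) => gh'; move/modhomP: (sh) => sh'.
  apply/modhomP => a v; apply: finj.
  by rewrite fh' !frE gh' sh' linearB.
clearbody r.
pose T := linfun (@precomp P' P M f); pose S := linfun (@precomp P P'' M g).
rewrite -(limg_ker_dim T (modhom P M)) addnC; congr addn.
  congr (\dim _); apply/vspaceP => h; apply/memv_imgP/idP => [[k kh ->]|hh].
    by rewrite lfunE; apply: modhom_comp.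
  exists (h \o r)%VF; first exact: modhom_comp.
  by rewrite lfunE; apply/lfunP => v; rewrite !comp_lfunE rf.
rewrite -(@limg_dim_eq _ _ _ S (modhom P'' M)).
  congr (\dim _); apply/vspaceP => h; rewrite memv_cap.
  apply/andP/memv_imgP => [[hh]|[k kh ->]].
    rewrite memv_ker lfunE => /eqP/lfunP hf.
    exists (h \o s)%VF; first exact: modhom_comp.
    rewrite lfunE; apply/lfunP => v; rewrite !comp_lfunE.
    apply/eqP; rewrite -subr_eq0 -linearB /= -frE.
    by rewrite -comp_lfunE hf lfunE.
  split; first by rewrite lfunE; apply: modhom_comp.
  by rewrite memv_ker !lfunE; apply/eqP/lfunP => v; rewrite !comp_lfunE gf linear0 lfunE.
apply/eqP; rewrite -subv0; apply/subvP => h; rewrite memv_cap memv_ker memv0.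
move=> /andP[_]; rewrite lfunE => /eqP/lfunP hg; apply/eqP/lfunP => v.
by have := hg (s v); rewrite /= /precomp comp_lfunE gsE => ->; rewrite !lfunE.
Qed.

Lemma dim_modhom_isor (P M N : fdmod) (f : 'Hom(M, N)) (g : 'Hom(N, M)) :
  f \in modhom M N -> g \in modhom N M ->
  (g \o f)%VF = \1%VF -> (f \o g)%VF = \1%VF ->
  \dim (modhom P M) = \dim (modhom P N).
Proof.
move=> fh gh gf fg; pose T := linfun (@postcomp P M N f).
rewrite -(@limg_dim_eq _ _ _ T (modhom P M)).
  congr (\dim _); apply/vspaceP => h; apply/memv_imgP/idP => [[k kh ->]|hh].
    by rewrite lfunE; apply: modhom_comp.
  exists (g \o h)%VF; first exact: modhom_comp.
  by rewrite lfunE /= /postcomp comp_lfunA fg comp_lfun1l.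
apply/eqP; rewrite -subv0; apply/subvP => h; rewrite memv_cap memv_ker memv0.
move=> /andP[_]; rewrite lfunE /= /postcomp => /eqP fh0.
by rewrite -[h]comp_lfun1l -gf -comp_lfunA fh0 comp_lfun0r.
Qed.

Lemma dim_modhom_isol (P Q M : fdmod) (f : 'Hom(P, Q)) (g : 'Hom(Q, P)) :
  f \in modhom P Q -> g \in modhom Q P ->
  (g \o f)%VF = \1%VF -> (f \o g)%VF = \1%VF ->
  \dim (modhom Q M) = \dim (modhom P M).
Proof.
move=> fh gh gf fg; pose T := linfun (@precomp P Q M f).
rewrite -(@limg_dim_eq _ _ _ T (modhom Q M)).
  congr (\dim _); apply/vspaceP => h; apply/memv_imgP/idP => [[k kh ->]|hh].
    by rewrite lfunE; apply: modhom_comp.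
  exists (h \o g)%VF; first exact: modhom_comp.
  by rewrite lfunE /= /precomp -comp_lfunA gf comp_lfun1r.
apply/eqP; rewrite -subv0; apply/subvP => h; rewrite memv_cap memv_ker memv0.
move=> /andP[_]; rewrite lfunE /= /precomp => /eqP fh0.
by rewrite -[h]comp_lfun1r -fg comp_lfunA fh0 comp_lfun0l.
Qed.

End Modules.

Section Grothendieck.
Variables (F : fieldType) (L : falgType F).

(* Every module is isomorphic to one on a space of row vectors.  The latter
   form a small family (which [fdmod L] does not), on which free groups can be
   built; see [coord_iso] for the comparison. *)
Record coordmod := CoordMod {
  coord_dim : nat;
  coord_act : L -> 'rV[F]_coord_dim -> 'rV[F]_coord_dim;
  coord_actP : is_action coord_act }.

Definition fdmod_of (c : coordmod) : fdmod L := FdMod (coord_actP c).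
Coercion fdmod_of : coordmod >-> fdmod.

Section Coordinates.
Variable M : fdmod L.

Definition coordmod_act (a : L) (r : 'rV[F]_(dim M)) : 'rV[F]_(dim M) :=
  v2r (act a (r2v r : M)).

Fact coordmod_actP : is_action coordmod_act.
Proof.
split=> [v k a b|a k u v|v|a b v]; rewrite /coordmod_act.
- by rewrite act_linl linearP.
- by rewrite linearP act_linr linearP.
- by rewrite act1 r2vK.
- by rewrite actM v2rK.
Qed.

Definition coordmod_of : coordmod := CoordMod coordmod_actP.

Lemma coord_iso : exists (f : 'Hom(M, coordmod_of)) (g : 'Hom(coordmod_of, M)),
  [/\ f \in modhom M coordmod_of, g \in modhom coordmod_of M,
      (g \o f)%VF = \1%VF & (f \o g)%VF = \1%VF].
Proof.
pose V : vectType F := 'rV[F]_(dim M).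
pose f : 'Hom(M, V) := linfun (v2r : M -> V).
pose g : 'Hom(V, M) := linfun (r2v : V -> M).
have fE v : f v = v2r v by rewrite lfunE.
have gE v : g v = r2v v by rewrite lfunE.
exists f, g; split.
- by apply/modhomP => a v; rewrite [LHS]fE [X in _ = act _ X]fE /= /coordmod_act v2rK.
- by apply/modhomP => a v; rewrite [LHS]gE [X in _ = act _ X]gE /= /coordmod_act v2rK.
- by apply/lfunP => v; rewrite comp_lfunE id_lfunE [LHS]gE fE v2rK.
- by apply/lfunP => v; rewrite comp_lfunE id_lfunE [LHS]fE gE r2vK.
Qed.

Fact coordmod_proj : projective M -> projective coordmod_of.
Proof.
have [f [g [fh gh gf fg]]] := coord_iso.
move=> Mproj A B p h ph hh psurj.
have [k kh kE] := Mproj A B p (h \o f)%VF ph (modhom_comp hh fh) psurj.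
exists (k \o g)%VF; first exact: modhom_comp.
by rewrite comp_lfunA kE -comp_lfunA fg comp_lfun1r.
Qed.

End Coordinates.

Section Group.
Variables (T : Type) (obj : T -> coordmod).

Definition K0_free := {freeg {classic T} / int}.
Definition K0_gen (M : T) : K0_free := << (M : {classic T}) >>.

(* The subgroup generated by the elements [M] - [M'] - [M''], for the short
   exact sequences 0 -> M' -> M -> M'' -> 0 with terms in the family [obj]. *)
Inductive K0_rel : K0_free -> Prop :=
| K0_rel0 : K0_rel 0
| K0_relB x y : K0_rel x -> K0_rel y -> K0_rel (x - y)
| K0_rel_ses M' M M'' (f : 'Hom(obj M', obj M)) (g : 'Hom(obj M, obj M'')) :
    short_exact f g -> K0_rel (K0_gen M - K0_gen M' - K0_gen M'').

Definition K0_relb : {pred K0_free} := [pred x | `[< K0_rel x >]].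

Fact K0_relb_closed : zmod_closed K0_relb.
Proof.
split=> [|x y]; rewrite !inE; first by apply/asboolP; exact: K0_rel0.
by move=> /asboolP hx /asboolP hy; apply/asboolP; exact: K0_relB.
Qed.

HB.instance Definition _ :=
  GRing.isZmodClosed.Build K0_free K0_relb K0_relb_closed.

Definition K0 : zmodType := Quotient.quot K0_relb.
Definition K0_class (M : T) : K0 := \pi_(Quotient.quot K0_relb) (K0_gen M).

End Group.

Definition coordproj := {c : coordmod | projective c}.
Definition coordproj_val (c : coordproj) : coordmod := sval c.

Definition coordproj_of (P : projmod L) : coordproj :=
  exist _ (coordmod_of P) (coordmod_proj (@projmodP _ _ P)).

Definition K0mod : zmodType := K0 (fun M : coordmod => M).
Definition K0proj : zmodType := K0 coordproj_val.

Definition class_mod (M : fdmod L) : K0mod :=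
  K0_class (fun M : coordmod => M) (coordmod_of M).
Definition class_proj (P : projmod L) : K0proj :=
  K0_class coordproj_val (coordproj_of P).

(* The bilinear extension of [dim Hom(P, M)] to free groups, evaluated at
   representatives.  The result does not depend on the latter, see
   [eulerBl], [eulerBr] and [eulerE]. *)
Definition euler_free (x : K0_free coordproj) (d : K0_free coordmod) : int :=
  fglift (fun P : {classic coordproj} =>
    fglift (fun M : {classic coordmod} =>
      (\dim (modhom (coordproj_val P) (M : coordmod)))%:Z : int^o) d : int^o) x.

Definition euler (x : K0proj) (d : K0mod) : int :=
  euler_free (repr x) (repr d).

Lemma euler_freeBl x y d :
  euler_free (x - y) d = euler_free x d - euler_free y d.
Proof. exact: (@lift_is_additive int {classic coordproj} int^o _ x y). Qed.

Lemma euler_freeBr x d e :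
  euler_free x (d - e) = euler_free x d - euler_free x e.
Proof.
elim/freeg_ind_dom0: x => [|k P x _ _ IH].
  by rewrite -[0](subrr 0) !euler_freeBl !subrr.
have E w : euler_free (<< k *g P >> + x) w = euler_free << k *g P >> w + euler_free x w.
  rewrite -[x in LHS]opprK euler_freeBl -[- x]sub0r euler_freeBl opprB addrC.
  by rewrite -[0](subrr 0) euler_freeBl subrr subr0 addrC.
rewrite !E IH opprD [RHS]addrACA; congr (_ + _).
by rewrite /euler_free !liftU lift_is_additive scalerBr.
Qed.

Lemma euler_freeE P M :
  euler_free (K0_gen P) (K0_gen M) = (\dim (modhom (coordproj_val P) M))%:Z.
Proof. by rewrite /euler_free !liftU !scale1r. Qed.

Let scale_aux (k a b : int) : k * (a + b) - k * a - k * b = 0.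
Proof. by rewrite mulrDr addrAC addrK subrr. Qed.

Lemma euler_free_rell x d : K0_rel coordproj_val x -> euler_free x d = 0.
Proof.
elim=> {x} [|x y _ hx _ hy|P' P P'' f g fg].
- by rewrite -[0](subrr 0) euler_freeBl !subrr.
- by rewrite euler_freeBl hx hy subrr.
elim/freeg_ind_dom0: d => [|k M d _ _ IH].
  by rewrite -[X in euler_free _ X](subrr 0) euler_freeBr subrr.
rewrite -[d]opprK euler_freeBr -[- d]sub0r euler_freeBr IH subr0.
rewrite -[X in _ - euler_free _ X](subrr 0) euler_freeBr subrr subr0.
rewrite !euler_freeBl /euler_free !liftU !scale1r.
by rewrite (dim_hom_exactl M (svalP P'') fg) PoszD; exact: scale_aux.
Qed.

Lemma euler_free_relr x d : K0_rel id d -> euler_free x d = 0.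
Proof.
elim=> {d} [|d e _ hd _ he|M' M M'' f g fg].
- by rewrite -[X in euler_free _ X](subrr 0) euler_freeBr !subrr.
- by rewrite euler_freeBr hd he subrr.
elim/freeg_ind_dom0: x => [|k P x _ _ IH].
  by rewrite -[0](subrr 0) euler_freeBl subrr.
rewrite -[x]opprK euler_freeBl -[- x]sub0r euler_freeBl IH subr0.
rewrite -[X in _ - euler_free X _](subrr 0) euler_freeBl subrr subr0.
rewrite !euler_freeBr /euler_free !liftU !scale1r.
by rewrite (dim_hom_exactr (svalP P) fg) PoszD; exact: scale_aux.
Qed.

Lemma euler_pi (x : K0_free coordproj) (d : K0_free coordmod) :
  euler (\pi_(Quotient.quot (K0_relb coordproj_val)) x)
        (\pi_(Quotient.quot (K0_relb id)) d) = euler_free x d.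
Proof.
have xE : repr (\pi_(Quotient.quot (K0_relb coordproj_val)) x) - x \in
    K0_relb coordproj_val by rewrite Quotient.idealrBE reprK.
have dE : repr (\pi_(Quotient.quot (K0_relb id)) d) - d \in K0_relb id.
  by rewrite Quotient.idealrBE reprK.
move: xE dE; rewrite !inE => /asboolP xE /asboolP dE; rewrite /euler.
apply/eqP; rewrite -subr_eq0.
have /eqP := euler_free_rell (repr (\pi_(Quotient.quot (K0_relb id)) d)) xE.
have /eqP := euler_free_relr x dE.
by rewrite euler_freeBl euler_freeBr !subr_eq0 => /eqP <- /eqP ->.
Qed.

Lemma eulerBl x y d : euler (x - y) d = euler x d - euler y d.
Proof.
by elim/quotW: x => x; elim/quotW: y => y; elim/quotW: d => d;
  rewrite -raddfB /= !euler_pi euler_freeBl.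
Qed.

Lemma eulerBr x d e : euler x (d - e) = euler x d - euler x e.
Proof.
by elim/quotW: x => x; elim/quotW: d => d; elim/quotW: e => e;
  rewrite -raddfB /= !euler_pi euler_freeBr.
Qed.

Lemma eulerE (P : projmod L) (M : fdmod L) :
  euler (class_proj P) (class_mod M) = (\dim (modhom P M))%:Z.
Proof.
rewrite euler_pi euler_freeE; congr Posz.
have [f [g [fh gh gf fg]]] := coord_iso P.
have [f' [g' [fh' gh' gf' fg']]] := coord_iso M.
rewrite -(dim_modhom_isol M fh gh gf fg).
by rewrite -(dim_modhom_isor (coordmod_of P) fh' gh' gf' fg').
Qed.

End Grothendieck.

Section Complexes.
Variables (F : fieldType) (L : falgType F).
Implicit Types i : int.

Record cplx := Cplx {
  cterm :> int -> fdmod L;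
  diff : forall i, 'Hom(cterm i, cterm (i + 1));
  diff_hom : forall i, diff i \in modhom (cterm i) (cterm (i + 1));
  diff_diff : forall i, (diff (i + 1) \o diff i)%VF = 0;
  bounded : exists n : nat, forall i : int, (n < absz i)%N -> is_zero (cterm i) }.

Record cmap (A B : cplx) := CMap {
  cmor :> forall i, 'Hom(A i, B i);
  cmor_hom : forall i, cmor i \in modhom (A i) (B i);
  cmor_diff : forall i, (diff B i \o cmor i)%VF = (cmor (i + 1) \o diff A i)%VF }.

Definition homotopic (A B : cplx) (f g : cmap A B) : Prop :=
  exists2 s : forall i, 'Hom(A (i + 1), B i),
    forall i, s i \in modhom (A (i + 1)) (B i) &
    forall i, f (i + 1) - g (i + 1) =
      (diff B i \o s i)%VF + (s (i + 1) \o diff A (i + 1))%VF.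

(* [f] induces isomorphisms on cohomology (injectivity and surjectivity). *)
Definition qis (A B : cplx) (f : cmap A B) : Prop :=
  (forall i (x : A (i + 1)) (y : B i),
     diff A (i + 1) x = 0 -> f (i + 1) x = diff B i y ->
     exists z : A i, x = diff A i z) /\
  (forall i (y : B (i + 1)), diff B (i + 1) y = 0 ->
     exists (x : A (i + 1)) (z : B i),
       diff A (i + 1) x = 0 /\ y = f (i + 1) x + diff B i z).

Section Identity.
Variable A : cplx.
Fact cid_hom i : \1%VF \in modhom (A i) (A i). Proof. exact: modhom_id. Qed.
Fact cid_diff i : (diff A i \o \1)%VF = (\1 \o diff A i)%VF.
Proof. by rewrite comp_lfun1l comp_lfun1r. Qed.
Definition cid : cmap A A := CMap cid_hom cid_diff.
Fact qis_id : qis cid.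
Proof.
split=> [i x y _|i y dy]; first by rewrite id_lfunE => ->; exists y.
by exists y, 0; rewrite id_lfunE linear0 addr0.
Qed.
End Identity.

Section Composition.
Variables (A B C : cplx) (g : cmap B C) (f : cmap A B).
Fact ccomp_hom i : (g i \o f i)%VF \in modhom (A i) (C i).
Proof. by apply: modhom_comp; apply: cmor_hom. Qed.
Fact ccomp_diff i :
  (diff C i \o (g i \o f i))%VF = ((g (i + 1) \o f (i + 1)) \o diff A i)%VF.
Proof. by rewrite comp_lfunA cmor_diff -comp_lfunA cmor_diff comp_lfunA. Qed.
Definition ccomp : cmap A C := CMap ccomp_hom ccomp_diff.
End Composition.

Lemma cmor_diffE (A B : cplx) (f : cmap A B) i x :
  diff B i (f i x) = f (i + 1) (diff A i x).
Proof. by rewrite -!comp_lfunE cmor_diff. Qed.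

Lemma qis_comp (A B C : cplx) (g : cmap B C) (f : cmap A B) :
  qis g -> qis f -> qis (ccomp g f).
Proof.
move=> [gi gs] [fi fs]; split=> [i x y dx|i y dy].
  rewrite comp_lfunE => gfx.
  have dfx : diff B (i + 1) (f (i + 1) x) = 0 by rewrite cmor_diffE dx linear0.
  by have [z /(fi _ _ _ dx)] := gi _ _ _ dfx gfx.
have [b [c [db ->]]] := gs _ _ dy; have [a [b' [da ->]]] := fs _ _ db.
exists a, (g i b' + c); split=> //.
by rewrite comp_lfunE linearD /= -cmor_diffE [diff C i (_ + _)]linearD addrA.
Qed.

Section Shift.
Variable A : cplx.
Definition shift_diff i : 'Hom(A (i + 1), A (i + 1 + 1)) := - diff A (i + 1).
Fact shift_diff_hom i : shift_diff i \in modhom (A (i + 1)) (A (i + 1 + 1)).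
Proof. by rewrite memvN diff_hom. Qed.
Fact shift_diff_diff i : (shift_diff (i + 1) \o shift_diff i)%VF = 0.
Proof. by rewrite comp_lfunNl comp_lfunNr opprK diff_diff. Qed.
Fact shift_bounded : exists n : nat,
  forall i : int, (n < absz i)%N -> is_zero (A (i + 1)).
Proof. by have [n An] := bounded A; exists n.+1 => i ni; apply: An; lia. Qed.
(* [A[1]]: terms [A (i + 1)] and differential [- d]. *)
Definition shift : cplx := Cplx shift_diff_hom shift_diff_diff shift_bounded.
End Shift.

Section ShiftMap.
Variables (A B : cplx) (f : cmap A B).
Fact cshift_hom i : f (i + 1) \in modhom (shift A i) (shift B i).
Proof. exact: cmor_hom. Qed.
Fact cshift_diff i :
  (diff (shift B) i \o f (i + 1))%VF = (f (i + 1 + 1) \o diff (shift A) i)%VF.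
Proof. by rewrite /= comp_lfunNl comp_lfunNr cmor_diff. Qed.
Definition cshift : cmap (shift A) (shift B) := CMap cshift_hom cshift_diff.

Fact qis_shift : qis f -> qis cshift.
Proof.
move=> [fi fs]; split=> [i x y|i y] /=; rewrite /shift_diff !opp_lfunE.
  move=> /eqP; rewrite oppr_eq0 => /eqP dx fx.
  have [|z ->] := fi _ _ (- y) dx; first by rewrite linearN.
  by exists (- z); rewrite opp_lfunE linearN opprK.
move=> /eqP; rewrite oppr_eq0 => /eqP /fs[x [z [dx ->]]].
exists x, (- z); rewrite !opp_lfunE dx oppr0; split=> //.
by rewrite linearN opprK.
Qed.
End ShiftMap.

Section Cone.
Variables (A B : cplx) (f : cmap A B).

Definition cone_term i : fdmod L := dsum (A (i + 1)) (B i).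
Definition cone_dfun i (v : cone_term i) : cone_term (i + 1) :=
  (- diff A (i + 1) v.1, f (i + 1) v.1 + diff B i v.2).
Fact cone_dfun_linear i : linear (@cone_dfun i).
Proof.
move=> k u v; rewrite /cone_dfun /= !linearP; congr pair => /=.
by rewrite scalerDr addrACA.
Qed.
HB.instance Definition _ i :=
  GRing.isLinear.Build F (cone_term i) (cone_term (i + 1)) *:%R (@cone_dfun i)
    (@cone_dfun_linear i).
Definition cone_diff i : 'Hom(cone_term i, cone_term (i + 1)) :=
  linfun (@cone_dfun i).
Fact cone_diff_hom i : cone_diff i \in modhom (cone_term i) (cone_term (i + 1)).
Proof.
apply/modhomP => a v; rewrite !lfunE /= /cone_dfun /= /dsum_act /=.
have /modhomP dA := diff_hom A (i + 1); have /modhomP dB := diff_hom B i.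
have /modhomP fh := cmor_hom f (i + 1).
by rewrite dA dB fh -linearN -linearD.
Qed.
Fact cone_diff_diff i : (cone_diff (i + 1) \o cone_diff i)%VF = 0.
Proof.
apply/lfunP => v; rewrite comp_lfunE !lfunE /= /cone_dfun /=.
rewrite [diff A _ (- _)]linearN [f _ (- _)]linearN [diff B _ (_ + _)]linearD /= cmor_diffE addrA.
by rewrite addNr add0r opprK -!comp_lfunE !diff_diff !zero_lfunE.
Qed.
Fact cone_bounded : exists n : nat,
  forall i : int, (n < absz i)%N -> is_zero (cone_term i).
Proof.
have [n An] := bounded A; have [m Bm] := bounded B.
exists (n + m).+1 => i ni [a b]; congr pair; [apply: An|apply: Bm]; lia.
Qed.
Definition cone : cplx := Cplx cone_diff_hom cone_diff_diff cone_bounded.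

Definition cone_in_fun i (b : B i) : cone i := (0, b).
Fact cone_in_fun_linear i : linear (@cone_in_fun i).
Proof. by move=> k u v; congr pair; rewrite /= scaler0 addr0. Qed.
HB.instance Definition _ i :=
  GRing.isLinear.Build F (B i) (cone i) *:%R (@cone_in_fun i)
    (@cone_in_fun_linear i).
Fact cone_in_hom i : linfun (@cone_in_fun i) \in modhom (B i) (cone i).
Proof.
apply/modhomP => a v; rewrite !lfunE /= /cone_in_fun /dsum_act /=; congr pair.
by rewrite linear0.
Qed.
Fact cone_in_diff i :
  (diff cone i \o linfun (@cone_in_fun i))%VF =
  (linfun (@cone_in_fun (i + 1)) \o diff B i)%VF.
Proof.
apply/lfunP => v; rewrite !comp_lfunE !lfunE /= /cone_dfun /cone_in_fun /=.
by rewrite !linear0 add0r.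
Qed.
Definition cone_in : cmap B cone := CMap cone_in_hom cone_in_diff.

Definition cone_out_fun i (v : cone i) : shift A i := v.1.
Fact cone_out_fun_linear i : linear (@cone_out_fun i).
Proof. by []. Qed.
HB.instance Definition _ i :=
  GRing.isLinear.Build F (cone i) (shift A i) *:%R (@cone_out_fun i)
    (@cone_out_fun_linear i).
Fact cone_out_hom i : linfun (@cone_out_fun i) \in modhom (cone i) (shift A i).
Proof. by apply/modhomP => a v; rewrite !lfunE. Qed.
Fact cone_out_diff i :
  (diff (shift A) i \o linfun (@cone_out_fun i))%VF =
  (linfun (@cone_out_fun (i + 1)) \o diff cone i)%VF.
Proof.
by apply/lfunP => v; rewrite !comp_lfunE !lfunE /= /cone_out_fun /shift_diff.
Qed.
Definition cone_out : cmap cone (shift A) := CMap cone_out_hom cone_out_diff.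

End Cone.

(* A morphism [A -> B] is represented by a roof [A <-(back)- apex -(fwd)-> B];
   equality of the represented morphisms is [roof_eq]. *)
Record roof (A B : cplx) := Roof {
  apex : cplx;
  back : cmap apex A;
  fwd : cmap apex B;
  back_qis : qis back }.

Definition roof_eq (A B : cplx) (r s : roof A B) : Prop :=
  exists (D : cplx) (p : cmap D (apex r)) (q : cmap D (apex s)),
    [/\ qis (ccomp (back r) p),
        homotopic (ccomp (back r) p) (ccomp (back s) q) &
        homotopic (ccomp (fwd r) p) (ccomp (fwd s) q)].

Definition roof_of (A B : cplx) (f : cmap A B) : roof A B :=
  Roof f (qis_id A).

(* [is_comp s r t]: the roof [t] represents the composite of [r] and [s]. *)
Definition is_comp (A B C : cplx) (s : roof B C) (r : roof A B) (t : roof A C)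
    : Prop :=
  exists (D : cplx) (p : cmap D (apex r)) (q : cmap D (apex s)) (hp : qis p),
    homotopic (ccomp (back s) q) (ccomp (fwd r) p) /\
    roof_eq t (Roof (ccomp (fwd s) q) (qis_comp (back_qis r) hp)).

Definition is_iso (A B : cplx) (r : roof A B) : Prop :=
  exists s : roof B A,
    is_comp s r (roof_of (cid A)) /\ is_comp r s (roof_of (cid B)).

(* The square  s \o r = s' \o r'  commutes in the derived category. *)
Definition commutes (A B B' C : cplx) (s : roof B C) (r : roof A B)
    (s' : roof B' C) (r' : roof A B') : Prop :=
  exists t : roof A C, is_comp s r t /\ is_comp s' r' t.

Definition roof_shift (A B : cplx) (r : roof A B) : roof (shift A) (shift B) :=
  Roof (cshift (fwd r)) (qis_shift (back_qis r)).

(* A triangle is distinguished if it is isomorphic to the triangle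
   [A -> B -> cone u -> A[1]] of a chain map [u]. *)
Definition distinguished (Y X Z : cplx)
    (f : roof Y X) (g : roof X Z) (h : roof Z (shift Y)) : Prop :=
  exists (A B : cplx) (u : cmap A B)
         (a : roof Y A) (b : roof X B) (c : roof Z (cone u)),
    [/\ is_iso a, is_iso b & is_iso c] /\
    [/\ commutes (roof_of u) a b f,
        commutes (roof_of (cone_in u)) b c g &
        commutes (roof_of (cone_out u)) c (roof_shift a) h].

Record two_term := TwoTerm {
  two_cplx :> cplx;
  two_proj : forall i, projective (two_cplx i);
  two_conc : forall i, i != -1 -> i != 0 -> is_zero (two_cplx i) }.

Definition term_proj (X : two_term) (i : int) : projmod L :=
  ProjMod (@two_proj X i).

Definition class_two (X : two_term) : K0proj L :=
  class_proj (term_proj X 0) - class_proj (term_proj X (-1)).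

(* A morphism of two-term complexes is the homotopy class of a chain map [f]. *)
Definition inflation (Y X : two_term) (f : cmap Y X) : Prop :=
  exists (Z : two_term) (g : roof X Z) (h : roof Z (shift Y)),
    distinguished (roof_of f) g h.

Definition semistable (X : two_term) (M : fdmod L) : Prop :=
  forall psi : 'Hom(X (-1), M), psi \in modhom (X (-1)) M ->
  exists! phi : 'Hom(X 0, M), phi \in modhom (X 0) M /\
     (phi \o (diff X (-1) : 'Hom(X (-1), X 0)))%VF = psi.

Definition numerically_semistable (X : two_term) (d : K0mod L) : Prop :=
  euler (class_two X) d = 0 /\
  forall (Y : two_term) (f : cmap Y X), inflation f -> 0 <= euler (class_two Y) d.

End Complexes.

(* Main.v *)
Require Import Defs.
From HB Require Import structures.
From mathcomp Require Import all_boot all_order all_algebra all_field.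
From mathcomp Require Import boolp reals complex.
From mathcomp Require Import zify.
From Stdlib Require Import Setoid Morphisms.
Import GRing.Theory.
Local Open Scope ring_scope.

(** In the derived category the argument is a long exact sequence.  Apply
    [Hom(-, M[1])] to the triangle [Y -> X -> Z -> Y[1]]: the group
    [Hom(Y, M[1])] sits between [Hom(X, M[1])] and [Hom(Z, M[2])].  The first
    is the cokernel of [x^*], zero by semistability; the second is zero because
    [Z] lives in degrees -1 and 0.  Hence the cokernel [Hom(Y, M[1])] of [y^*]
    vanishes, [y^*] is onto, and
    [dim Hom(Y^0, M) - dim Hom(Y^-1, M) >= 0].  The equality
    [<[X], [M]> = 0] only says that [x^*] is bijective.

    The vanishing of [Hom(Z, M[2])] is used in the following chain-level form.
    The cone of [f : Y -> X] is the complex [Y^-1 -> Y^0 (+) X^-1 -> X^0] in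
    degrees -2, -1, 0.  All its terms are projective, and it is isomorphic to
    [Z] in the derived category, so it is homotopy equivalent to [Z]; as
    [Z^-2 = 0], the homotopy from the identity to a map through [Z] is, in
    degree -2, a retraction of [Y^-1 -> Y^0 (+) X^-1]
    ([inflation_retraction]).  Consequently any [psi : Y^-1 -> M] extends to
    [Y^0 (+) X^-1], that is [psi = phi y + chi f^-1]; semistability writes
    [chi = chi' x], and [chi' x f^-1 = chi' f^0 y], so [psi] factors through
    [y] ([inflation_precomp_surj]).

    What remains is to turn the roofs of the distinguished triangle into chain
    maps.  A map from a bounded complex of projectives to an acyclic complex is
    null-homotopic ([homotopic_acyclic]); applied to mapping cones, this lifts
    maps through quasi-isomorphisms, uniquely up to homotopy ([lift_qis],
    [homotopic_cancel_qis]).  The isomorphism of triangles then becomes a square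
    of chain maps commuting up to homotopy ([commutes_lift]), which induces a
    quasi-isomorphism of cones ([cone_map_qis]). *)

Set Implicit Arguments.
Unset Strict Implicit.
Unset Printing Implicit Defensive.

(** * Chain maps up to homotopy and quasi-isomorphisms *)

Section Derived.
Variables (F : fieldType) (L : falgType F).
Implicit Types A B C D : cplx L.

(** [qis f] is by definition the conjunction [homology_inj f /\ homology_surj f].
    The two halves are named because they cancel separately in composites, and
    this is how an isomorphism in the derived category is seen to be represented
    by a quasi-isomorphism. *)
Definition homology_inj A B (f : cmap A B) : Prop :=
  forall i (x : A (i + 1)) (y : B i),
    diff A (i + 1) x = 0 -> f (i + 1) x = diff B i y ->
    exists z : A i, x = diff A i z.

Definition homology_surj A B (f : cmap A B) : Prop :=
  forall i (y : B (i + 1)), diff B (i + 1) y = 0 ->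
    exists (x : A (i + 1)) (z : B i),
      diff A (i + 1) x = 0 /\ y = f (i + 1) x + diff B i z.

Lemma diff_diffE A i (x : A i) : diff A (i + 1) (diff A i x) = 0.
Proof. by rewrite -comp_lfunE diff_diff zero_lfunE. Qed.

Lemma ccompE A B C (g : cmap B C) (f : cmap A B) i x :
  ccomp g f i x = g i (f i x).
Proof. by rewrite comp_lfunE. Qed.

Lemma homotopicE A B (f g : cmap A B) : homotopic f g ->
  exists2 s : forall i, 'Hom(A (i + 1), B i),
    forall i, s i \in modhom (A (i + 1)) (B i) &
    forall i x, f (i + 1) x =
      g (i + 1) x + (diff B i (s i x) + s (i + 1) (diff A (i + 1) x)).
Proof.
move=> [s sh sE]; exists s => // i x.
have /lfunP/(_ x) := sE i.
rewrite !add_lfunE opp_lfunE !comp_lfunE => <-.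
by rewrite [RHS]addrC subrK.
Qed.

Lemma homotopicI A B (f g : cmap A B) (s : forall i, 'Hom(A (i + 1), B i)) :
  (forall i, s i \in modhom (A (i + 1)) (B i)) ->
  (forall i x, f (i + 1) x =
      g (i + 1) x + (diff B i (s i x) + s (i + 1) (diff A (i + 1) x))) ->
  homotopic f g.
Proof.
move=> sh sE; exists s => // i; apply/lfunP => x.
by rewrite !add_lfunE opp_lfunE !comp_lfunE sE addrAC subrr add0r.
Qed.

Lemma homotopic_ext A B (f g : cmap A B) :
  (forall i, f i = g i) -> homotopic f g.
Proof.
move=> fg; apply: (@homotopicI _ _ _ _ (fun i => 0)) => [i|i x].
  exact: mem0v.
by rewrite fg !zero_lfunE linear0 !addr0.
Qed.

Lemma homotopic_sym A B (f g : cmap A B) : homotopic f g -> homotopic g f.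
Proof.
move=> [s sh sE]; exists (fun i => - s i) => [i|i]; first by rewrite memvN sh.
by rewrite comp_lfunNl comp_lfunNr -opprD -sE opprB.
Qed.

Lemma homotopic_trans A B (g f h : cmap A B) :
  homotopic f g -> homotopic g h -> homotopic f h.
Proof.
move=> [s sh sE] [t th tE]; exists (fun i => s i + t i) => [i|i].
  by rewrite memvD ?sh ?th.
by rewrite comp_lfunDl comp_lfunDr addrACA -sE -tE addrA subrK.
Qed.

Lemma homotopic_compl A B C (h : cmap B C) (f g : cmap A B) :
  homotopic f g -> homotopic (ccomp h f) (ccomp h g).
Proof.
move=> /homotopicE[s sh sE].
apply: (@homotopicI _ _ _ _ (fun i => (h i \o s i)%VF)) => [i|i x].
  by apply: modhom_comp => //; apply: cmor_hom.
by rewrite !ccompE !comp_lfunE sE !linearD /= cmor_diffE.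
Qed.

Lemma homotopic_compr A B C (h : cmap A B) (f g : cmap B C) :
  homotopic f g -> homotopic (ccomp f h) (ccomp g h).
Proof.
move=> /homotopicE[s sh sE].
apply: (@homotopicI _ _ _ _ (fun i => (s i \o h (i + 1))%VF)) => [i|i x].
  by apply: modhom_comp => //; apply: cmor_hom.
by rewrite !ccompE !comp_lfunE sE -cmor_diffE.
Qed.

Lemma ccompA A B C D (h : cmap C D) (g : cmap B C) (f : cmap A B) :
  homotopic (ccomp h (ccomp g f)) (ccomp (ccomp h g) f).
Proof. by apply: homotopic_ext => i /=; rewrite comp_lfunA. Qed.

Lemma ccomp_idl A B (f : cmap A B) : homotopic (ccomp (Defs.cid B) f) f.
Proof. by apply: homotopic_ext => i /=; rewrite comp_lfun1l. Qed.

Lemma ccomp_idr A B (f : cmap A B) : homotopic (ccomp f (Defs.cid A)) f.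
Proof. by apply: homotopic_ext => i /=; rewrite comp_lfun1r. Qed.

(** Homotopic maps differ by boundaries on cocycles. *)
Lemma homology_inj_homotopic A B (f g : cmap A B) :
  homotopic f g -> homology_inj f -> homology_inj g.
Proof.
move=> /homotopicE[s _ sE] fi i x y dx gx; apply: (fi i x (y + s i x)) => //.
by rewrite sE dx gx linearD linear0 addr0.
Qed.

Lemma homology_surj_homotopic A B (f g : cmap A B) :
  homotopic f g -> homology_surj f -> homology_surj g.
Proof.
move=> /homotopicE[s _ sE] fs i y /fs[x [z [dx ->]]].
exists x, (s i x + z); split=> //.
by rewrite sE dx !linearD linear0 addr0 /= addrA.
Qed.

Lemma qis_homotopic A B (f g : cmap A B) : homotopic f g -> qis f -> qis g.
Proof.
move=> fg [fi fs]; split.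
  exact: homology_inj_homotopic fg fi.
exact: homology_surj_homotopic fg fs.
Qed.

Lemma homology_inj_comp A B C (g : cmap B C) (f : cmap A B) :
  homology_inj g -> homology_inj f -> homology_inj (ccomp g f).
Proof.
move=> gi fi i x y dx; rewrite ccompE => gfx.
have dfx : diff B (i + 1) (f (i + 1) x) = 0 by rewrite cmor_diffE dx linear0.
by have [z /(fi _ _ _ dx)] := gi _ _ _ dfx gfx.
Qed.

Lemma homology_inj_compr A B C (g : cmap B C) (f : cmap A B) :
  homology_inj (ccomp g f) -> homology_inj f.
Proof.
move=> gfi i x y dx fx; apply: (gfi i x (g i y)) => //.
by rewrite ccompE fx cmor_diffE.
Qed.

Lemma homology_surj_compl A B C (g : cmap B C) (f : cmap A B) :
  homology_surj (ccomp g f) -> homology_surj g.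
Proof.
move=> gfs i y /gfs[x [z [dx ->]]]; exists (f (i + 1) x), z; split.
  by rewrite cmor_diffE dx linear0.
by rewrite ccompE.
Qed.

Lemma homology_inj_cancelr A B C (g : cmap B C) (f : cmap A B) :
  homology_surj f -> homology_inj (ccomp g f) -> homology_inj g.
Proof.
move=> fs gfi i x y /fs[x' [z [dx ->]]] gx.
have [|w ->] := gfi i x' (y - g i z) dx.
  apply/eqP; rewrite ccompE linearB /= -gx linearD /= cmor_diffE.
  by rewrite [_ + g _ _]addrC addrAC subrr add0r.
by exists (f i w + z); rewrite linearD /= cmor_diffE.
Qed.

Lemma homology_surj_cancell A B C (g : cmap B C) (f : cmap A B) :
  homology_inj g -> homology_surj (ccomp g f) -> homology_surj f.
Proof.
move=> gi gfs i y dy.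
have [|x [z [dx]]] := gfs i (g (i + 1) y).
  by rewrite cmor_diffE dy linear0.
rewrite ccompE => gy.
have [||w /eqP] := gi i (y - f (i + 1) x) z.
- by rewrite linearB /= dy cmor_diffE dx linear0 subrr.
- by rewrite linearB /= gy [LHS]addrAC subrr add0r.
by rewrite subr_eq [X in _ == X]addrC => /eqP ->; exists x, w.
Qed.

Lemma qis_cancell A B C (g : cmap B C) (f : cmap A B) :
  qis g -> qis (ccomp g f) -> qis f.
Proof.
move=> [gi gs] [gfi gfs]; split; first exact: homology_inj_compr gfi.
exact: homology_surj_cancell gi gfs.
Qed.

Lemma qis_cancelr A B C (g : cmap B C) (f : cmap A B) :
  qis f -> qis (ccomp g f) -> qis g.
Proof.
move=> [fi fs] [gfi gfs]; split; first exact: homology_inj_cancelr fs gfi.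
exact: homology_surj_compl gfs.
Qed.

(** If [s] after [r] is the identity then [r] is injective and [s] surjective
    on cohomology.  With the roofs drawn as

      A <- r -> B <- s -> A,

    let [D] be the apex of the composite.  The backward maps of [r] and [s] and
    [D -> r] are quasi-isomorphisms, and comparison with the identity roof makes
    the total forward map [D -> s -> A] one too. *)
Lemma is_comp_id_inj_surj A B (r : roof A B) (s : roof B A) :
  is_comp s r (roof_of (Defs.cid A)) ->
  homology_inj (fwd r) /\ homology_surj (fwd s).
Proof.
move=> [D [p [q [qp [sq [E [P [Q /= [qP hb hf]]]]]]]]].
have qQ : qis Q.
  apply: (@qis_cancell _ _ _ (ccomp (back r) p)).
    by apply: qis_comp; first exact: back_qis.
  exact: qis_homotopic hb qP.
have [sqi sqs] : qis (ccomp (fwd s) q).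
  by apply: qis_cancelr qQ _; exact: qis_homotopic hf qP.
split; last exact: homology_surj_compl sqs.
have [pi ps] := qp; apply: homology_inj_cancelr ps _.
apply: (homology_inj_homotopic sq).
have qi : homology_inj q by apply: homology_inj_compr sqi.
by apply: homology_inj_comp qi; case: (back_qis s).
Qed.

(** The two composites of [r] with its inverse each give one half of the
    claim. *)
Lemma is_iso_qis A B (r : roof A B) : is_iso r -> qis (fwd r).
Proof.
by move=> [s [/is_comp_id_inj_surj[ri _] /is_comp_id_inj_surj[_ rs]]].
Qed.

End Derived.

(** * Projective modules and acyclic complexes *)

Section Image.
Variables (F : fieldType) (L : falgType F) (M N : fdmod L).
Variables (g : 'Hom(M, N)) (gh : g \in modhom M N).

(** Projectivity is stated for surjections; the image of [g], as a module, is
    what makes it applicable to a map that is not onto. *)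
Definition image_act (a : L) (w : subvs_of (limg g)) : subvs_of (limg g) :=
  vsproj (limg g) (act a (vsval w)).

Lemma image_actE a w : vsval (image_act a w) = act a (vsval w).
Proof.
rewrite /image_act vsprojK //; have /memv_imgP[x _ ->] := subvsP w.
by move/modhomP: gh => <-; apply: memv_img; apply: memvf.
Qed.

Fact image_actP : is_action image_act.
Proof.
split=> [v k a b|a k u v|v|a b v]; apply: subvs_inj.
- by rewrite linearP /= !image_actE act_linl.
- by rewrite [RHS]linearP /= !image_actE -[RHS]act_linr.
- by rewrite /= image_actE act1.
- by rewrite /= !image_actE actM.
Qed.

Definition image_mod : fdmod L := FdMod image_actP.

End Image.

Section Projective.
Variables (F : fieldType) (L : falgType F).
Implicit Types A B C D P E W V : cplx L.

Lemma projective_lift (P M N : fdmod L) (g : 'Hom(M, N)) (h : 'Hom(P, N)) :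
  projective P -> g \in modhom M N -> h \in modhom P N ->
  (forall v, exists w, h v = g w) ->
  exists2 k : 'Hom(P, M), k \in modhom P M & forall v, g (k v) = h v.
Proof.
move=> Pproj gh hh hg.
have hU v : h v \in limg g by have [w ->] := hg v; rewrite memv_img ?memvf.
have gU v : g v \in limg g by rewrite memv_img ?memvf.
pose U : vectType F := subvs_of (limg g).
pose pr : 'Hom(N, U) := linfun (vsproj (limg g)).
have prE v : v \in limg g -> vsval (pr v) = v.
  by move=> vU; rewrite lfunE /= vsprojK.
pose I := image_mod gh.
have prh (A : fdmod L) (f : 'Hom(A, N)) : f \in modhom A N ->
    (forall v, f v \in limg g) -> ((pr \o f)%VF : 'Hom(A, I)) \in modhom A I.
  move=> /modhomP fh fU; apply/modhomP => a v; apply: subvs_inj.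
  rewrite (image_actE gh) [X in act _ (vsval X)]comp_lfunE.
  by rewrite [X in vsval X]comp_lfunE !prE.
have [|k kh kE] := Pproj M I _ _ (prh _ _ gh gU) (prh _ _ hh hU).
  apply/vspaceP => w; rewrite memvf; apply/memv_imgP.
  have /memv_imgP[x _ wE] := subvsP w.
  by exists x; rewrite ?memvf //; apply: val_inj; rewrite /= comp_lfunE prE.
exists k => // v; have /lfunP/(_ v)/(congr1 vsval) := kE.
by rewrite !comp_lfunE !prE.
Qed.

Definition acyclic E : Prop :=
  forall i (y : E (i + 1)), diff E (i + 1) y = 0 -> exists z, y = diff E i z.

(** The homotopy is built by descending induction on the degree, starting above
    the range where [P] is nonzero.  Once it satisfies the homotopy identity in
    degrees above [j + 1], the defect [r] left in degree [j + 1] takes values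
    in cocycles, hence in boundaries, and projectivity of [P (j + 1)] lifts it
    through [diff E j].  Changing the homotopy at the single index [j] does not
    affect the identities already obtained. *)
Lemma homotopic_acyclic P E (f g : cmap P E) :
  (forall i, projective (P i)) -> acyclic E -> homotopic f g.
Proof.
move=> Pproj Eacyc.
have [n Pn] := bounded P.
have P0 i (x : P i) : (n < absz i)%N -> x = 0 by move=> ni; apply: Pn.
(* After [n + (n + 2)] steps the remaining degrees lie below [- n], where [P]
   vanishes. *)
suff H k : exists2 s : forall i, 'Hom(P (i + 1), E i),
    forall i, s i \in modhom (P (i + 1)) (E i) &
    forall i x, n%:Z - k%:Z <= i -> f (i + 1) x =
      g (i + 1) x + (diff E i (s i x) + s (i + 1) (diff P (i + 1) x)).
  have [s sh sE] := H (n + n.+2)%N.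
  apply: (homotopicI sh) => i x.
  have [ni|ni] := boolP (n%:Z - (n + n.+2)%N%:Z <= i); first exact: sE.
  by rewrite (P0 _ x) ?linear0 ?addr0 ?linear0 //; lia.
elim: k => [|k [s sh sE]].
  exists (fun i => 0) => [i|i x ni]; first exact: mem0v.
  by rewrite (P0 _ x) ?linear0 ?addr0 ?linear0 //; lia.
pose j := n%:Z - k.+1%:Z.
pose r := f (j + 1) - g (j + 1) - (s (j + 1) \o diff P (j + 1))%VF.
have rE x : r x = f (j + 1) x - g (j + 1) x - s (j + 1) (diff P (j + 1) x).
  by rewrite !(add_lfunE, opp_lfunE) comp_lfunE.
have rh : r \in modhom (P (j + 1)) (E (j + 1)).
  by rewrite !rpredB ?cmor_hom ?modhom_comp ?diff_hom.
have dr x : exists z, r x = diff E j z.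
  apply: Eacyc; rewrite rE !linearB /= !cmor_diffE sE; last by lia.
  by rewrite diff_diffE linear0 addr0 [LHS]addrAC addrK subrr.
have [t th tE] := projective_lift (Pproj _) (diff_hom E j) rh dr.
exists (dfwith s t) => [i|i x ki].
  by have [->|ij] := eqVneq i j; rewrite ?dfwith_in // dfwith_out 1?eq_sym.
have -> : dfwith s t (i + 1) = s (i + 1).
  by rewrite dfwith_out //; apply/eqP; lia.
have [ij|ij] := eqVneq i j; last first.
  by rewrite dfwith_out 1?eq_sym // sE //; move/eqP: ij; lia.
move: x ki; rewrite {i}ij => x _; rewrite dfwith_in tE rE subrK.
by rewrite [RHS]addrC subrK.
Qed.
End Projective.

(** * Lifting through quasi-isomorphisms *)

Section DsumProj.
Variables (F : fieldType) (L : falgType F) (M N P : fdmod L).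

Definition dsum_fst : 'Hom(dsum M N, M) := linfun (fst : dsum M N -> M).
Definition dsum_snd : 'Hom(dsum M N, N) := linfun (snd : dsum M N -> N).

Lemma dsum_fstE v : dsum_fst v = v.1. Proof. by rewrite lfunE. Qed.
Lemma dsum_sndE v : dsum_snd v = v.2. Proof. by rewrite lfunE. Qed.

Lemma dsum_fst_hom : dsum_fst \in modhom (dsum M N) M.
Proof. by apply/modhomP => a v; rewrite !dsum_fstE. Qed.
Lemma dsum_snd_hom : dsum_snd \in modhom (dsum M N) N.
Proof. by apply/modhomP => a v; rewrite !dsum_sndE. Qed.

Definition dsum_pair_fun (f : 'Hom(P, M)) (g : 'Hom(P, N)) (v : P) : dsum M N :=
  (f v, g v).
Fact dsum_pair_linear f g : linear (dsum_pair_fun f g).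
Proof. by move=> k u v; rewrite /dsum_pair_fun !linearP. Qed.
HB.instance Definition _ f g :=
  GRing.isLinear.Build F P (dsum M N) *:%R (dsum_pair_fun f g)
    (dsum_pair_linear f g).
Definition dsum_pair f g : 'Hom(P, dsum M N) := linfun (dsum_pair_fun f g).

Lemma dsum_pairE f g v : dsum_pair f g v = (f v, g v).
Proof. by rewrite lfunE. Qed.

Lemma dsum_pair_hom f g :
  f \in modhom P M -> g \in modhom P N -> dsum_pair f g \in modhom P (dsum M N).
Proof.
move=> /modhomP fh /modhomP gh; apply/modhomP => a v.
by rewrite !dsum_pairE fh gh.
Qed.
End DsumProj.

Section Lifting.
Variables (F : fieldType) (L : falgType F).
Implicit Types A B C D P E W V : cplx L.

(** Homotopies and differentials have terms of index [i + 1], which is not the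
    form of a variable index; the next two lemmas pass from [i + 1] to [i]
    without leaving casts behind. *)
Lemma int_succ_ind (T : int -> Prop) : (forall i, T (i + 1)) -> forall i, T i.
Proof. by move=> H i; rewrite -(subrK 1 i). Qed.

Lemma int_succ_family (T : int -> Type) (h : forall i, T (i + 1)) :
  exists h' : forall i, T i, forall i, h' (i + 1) = h i.
Proof.
exists (fun i => ecast j (T j) (subrK 1 i) (h (i - 1))) => i.
by move: (i + 1 - 1) (addrK 1 i) (subrK 1 (i + 1)) => j -> e; rewrite eq_axiomK.
Qed.

Lemma coneE A B (f : cmap A B) i (v : cone f i) :
  diff (cone f) i v = (- diff A (i + 1) v.1, f (i + 1) v.1 + diff B i v.2).
Proof. by rewrite lfunE. Qed.

Fact czero_hom A B i : (0 : 'Hom(A i, B i)) \in modhom (A i) (B i).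
Proof. exact: mem0v. Qed.
Fact czero_diff A B i :
  (diff B i \o (0 : 'Hom(A i, B i)))%VF =
  ((0 : 'Hom(A (i + 1), B (i + 1))) \o diff A i)%VF.
Proof. by rewrite comp_lfun0l comp_lfun0r. Qed.
Definition czero A B : cmap A B := CMap (@czero_hom A B) (@czero_diff A B).

(** Long exact sequence of the cone, read off on elements: a cocycle [(w, v)]
    says that [q w] is a boundary, so [w = d z]; then [v + q z] is a cocycle,
    hence comes from a cocycle [x] of [W] up to a boundary. *)
Lemma acyclic_cone W V (q : cmap W V) : qis q -> acyclic (cone q).
Proof.
move=> [qi qs] i [w v]; rewrite coneE => -[/= /eqP].
rewrite oppr_eq0 => /eqP dw /eqP; rewrite addr_eq0 => /eqP qw.
have [|z wE] := qi _ w (- v) dw; first by rewrite linearN.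
have [|x [y [dx vE]]] := qs _ (v + q (i + 1) z).
  by rewrite linearD /= cmor_diffE -wE qw [LHS]addrN.
exists (x - z, y).
rewrite coneE /=; congr pair; first by rewrite linearB /= dx sub0r opprK.
by rewrite linearB /= [RHS]addrAC -vE addrK.
Qed.

(** The composite of [f] with [V -> cone q] is null-homotopic because the cone is
    acyclic.  The first component of the null-homotopy is a chain map
    [P -> W], and its second component is a homotopy from [f] to the composite
    of that map with [q]. *)
Lemma lift_qis P W V (q : cmap W V) (f : cmap P V) :
  (forall i, projective (P i)) -> qis q ->
  exists g : cmap P W, homotopic (ccomp q g) f.
Proof.
move=> Pproj qq.
have /homotopicE[s sh sE] : homotopic (ccomp (cone_in q) f) (czero P (cone q)).
  apply: homotopic_acyclic => //; exact: acyclic_cone.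
have [t tE] := @int_succ_family (fun i => 'Hom(P i, W i))
  (fun i => (dsum_fst (W (i + 1)) (V i) \o s i)%VF).
have tsE i x : t (i + 1) x = (s i x).1 by rewrite tE comp_lfunE dsum_fstE.
have th i : t i \in modhom (P i) (W i).
  elim/int_succ_ind: i => i.
  by rewrite tE; apply: modhom_comp; first exact: dsum_fst_hom.
have tdE i x : (diff W (i + 1) (s i x).1) = (s (i + 1) (diff P (i + 1) x)).1 /\
  f (i + 1) x = q (i + 1) (s i x).1 + diff V i (s i x).2 +
     (s (i + 1) (diff P (i + 1) x)).2.
  have := sE i x; rewrite ccompE lfunE zero_lfunE add0r coneE.
  case=> /eqP; rewrite eq_sym [X in X == _]addrC subr_eq0 => /eqP <- ->.
  by [].
have td i : (diff W i \o t i)%VF = (t (i + 1) \o diff P i)%VF.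
  elim/int_succ_ind: i => i; apply/lfunP => x; rewrite !comp_lfunE !tsE.
  by case: (tdE i x).
exists (CMap th td); apply: homotopic_sym.
apply: (@homotopicI _ _ _ _ _ _
  (fun i => (dsum_snd (W (i + 1)) (V i) \o s i)%VF)).
  by move=> i; apply: modhom_comp; first exact: dsum_snd_hom.
move=> i x; rewrite ccompE /= tsE !comp_lfunE !dsum_sndE addrA.
by case: (tdE i x).
Qed.

(** A homotopy [r] between [q f] and [q g] is exactly what makes [(f - g, - r)]
    a chain map from [P[1]] to the cone of [q].  As the cone is acyclic this map
    is null-homotopic, and the first component of the null-homotopy is, up to
    sign, a homotopy between [f] and [g]. *)
Lemma homotopic_cancel_qis P W V (q : cmap W V) (f g : cmap P W) :
  (forall i, projective (P i)) -> qis q ->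
  homotopic (ccomp q f) (ccomp q g) -> homotopic f g.
Proof.
move=> Pproj qq /homotopicE[r rh rE].
pose m i : 'Hom(shift P i, cone q i) := dsum_pair (f (i + 1) - g (i + 1)) (- r i).
have mE i x : m i x = (f (i + 1) x - g (i + 1) x, - r i x).
  by rewrite dsum_pairE add_lfunE !opp_lfunE.
have mh i : m i \in modhom (shift P i) (cone q i).
  apply: dsum_pair_hom; [apply: rpredB; exact: cmor_hom | rewrite memvN; exact: rh].
have md i : (diff (cone q) i \o m i)%VF = (m (i + 1) \o diff (shift P) i)%VF.
  apply/lfunP => x; rewrite !comp_lfunE [m i x]mE coneE [RHS]mE /=.
  rewrite /shift_diff opp_lfunE !linearN !linearB /= !cmor_diffE.
  have := rE i x; rewrite !ccompE => ->; congr pair.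
  by rewrite opprK [X in X - _]addrAC subrr add0r [LHS]addrAC subrr add0r.
have /homotopicE[s sh sE] : homotopic (CMap mh md) (czero (shift P) (cone q)).
  by apply: homotopic_acyclic => [i|]; [exact: Pproj | exact: acyclic_cone].
have [t tE] := @int_succ_family (fun i => 'Hom(P (i + 1), W i))
  (fun i => - (dsum_fst (W (i + 1)) (V i) \o s i)%VF).
have tsE i x : t (i + 1) x = - (s i x).1.
  by rewrite tE opp_lfunE comp_lfunE dsum_fstE.
exists t => i; elim/int_succ_ind: i => i.
  by rewrite tE memvN; apply: modhom_comp; [exact: dsum_fst_hom | exact: sh].
apply/lfunP => x; rewrite !(add_lfunE, opp_lfunE) !comp_lfunE !tsE.
have := sE i x; rewrite /= mE zero_lfunE add0r coneE => -[-> _].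
by rewrite linearN /shift_diff opp_lfunE [s _ (- _)]linearN.
Qed.
End Lifting.

(** * Commutative squares and their cones *)

#[local] Instance homotopic_equivalence (F : fieldType) (L : falgType F)
    (A B : cplx L) :
  Equivalence (@homotopic F L A B).
Proof.
split=> [f|f g|f g h]; first exact: homotopic_ext.
  exact: homotopic_sym.
exact: homotopic_trans.
Qed.

#[local] Instance ccomp_homotopic (F : fieldType) (L : falgType F)
    (A B C : cplx L) :
  Proper (@homotopic F L B C ==> @homotopic F L A B ==> @homotopic F L A C)
    (@ccomp F L A B C).
Proof.
move=> g g' gg' f f' ff'; apply: homotopic_trans (homotopic_compl _ ff') _.
exact: homotopic_compr.
Qed.

Section Square.
Variables (F : fieldType) (L : falgType F).

Lemma section_qis (P W : cplx L) (q : cmap W P) :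
  (forall i, projective (P i)) -> qis q ->
  exists2 s : cmap P W, qis s & homotopic (ccomp q s) (Defs.cid P).
Proof.
move=> Pproj qq; have [s qs] := lift_qis (Defs.cid P) Pproj qq.
exists s => //; apply: qis_cancell qq _.
exact: qis_homotopic (homotopic_sym qs) (qis_id P).
Qed.

(** Both composites of the square are represented by the common roof [t].  Each of
    the two comparisons of [t] with a composite provides a complex
    quasi-isomorphic to [Y] ([E] and [E'] below), through which the identity of
    [Y] lifts; the two lifts agree in the apex of [t] up to homotopy because they
    agree in [Y].  Following them into [A] and into the apex of [b] gives [a']
    and [g], and [g] is compared with [f] by lifting the identity of [X] to the
    apex of [b]. *)
Lemma commutes_lift (Y X A B : cplx L) (f : cmap Y X) (u : cmap A B)
    (a : roof Y A) (b : roof X B) :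
  (forall i, projective (Y i)) -> (forall i, projective (X i)) ->
  is_iso a -> is_iso b -> commutes (roof_of u) a b (roof_of f) ->
  exists (a' : cmap Y A) (b' : cmap X B),
    [/\ qis a', qis b' & homotopic (ccomp b' f) (ccomp u a')].
Proof.
move=> Yproj Xproj /is_iso_qis qa /is_iso_qis qb [t [ct1 ct2]].
have [D [p [q [qp [/= hq [E [P [Q /= [qP hb hf]]]]]]]]] := ct1.
have [D' [p' [q' [qp' [/= hq' [E' [P' [Q' /= [qP' hb' hf']]]]]]]]] := ct2.
have [s qs st] := section_qis Yproj qP.
have [s' qs' st'] := section_qis Yproj qP'.
have [r qr br] := section_qis Xproj (back_qis b).
have Ps : homotopic (ccomp P s) (ccomp P' s').
  apply: (homotopic_cancel_qis Yproj (back_qis t)).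
  rewrite !ccompA st st'; reflexivity.
pose a' := ccomp (ccomp q Q) s; pose g := ccomp (ccomp q' Q') s'.
have ug : homotopic (ccomp u a') (ccomp (fwd b) g).
  rewrite /a' /g !ccompA -hf -hf' -!ccompA Ps; reflexivity.
have bg : homotopic (ccomp (back b) g) f.
  rewrite /g !ccompA hq' -!ccompA -[X in homotopic _ X]ccomp_idr -st' hb'.
  by rewrite ccomp_idl -!ccompA; reflexivity.
have rf : homotopic (ccomp r f) g.
  apply: (homotopic_cancel_qis Yproj (back_qis b)).
  rewrite ccompA br bg ccomp_idl; reflexivity.
exists a', (ccomp (fwd b) r); split.
- apply: qis_comp qs; apply: qis_comp.
    apply: qis_homotopic (ccomp_idl q) _.
    exact: qis_homotopic (homotopic_sym hq) (qis_comp qa qp).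
  apply: qis_cancell (qis_comp (back_qis a) qp) _.
  exact: qis_homotopic hb qP.
- exact: qis_comp.
- rewrite -ccompA rf ug; reflexivity.
Qed.

(** The map of cones is [(y, x) |-> (a y, b x + s y)] with [s] the homotopy
    filling the square.  That it is a quasi-isomorphism is the five lemma for
    the long exact sequences of the two cones, carried out on elements. *)
Lemma cone_map_qis (Y X A B : cplx L) (f : cmap Y X) (u : cmap A B)
    (a : cmap Y A) (b : cmap X B) :
  qis a -> qis b -> homotopic (ccomp b f) (ccomp u a) ->
  exists m : cmap (cone f) (cone u), qis m.
Proof.
move=> [ai asurj] [bi bsurj] /homotopicE[s sh sE].
pose m i : 'Hom(cone f i, cone u i) :=
  dsum_pair (a (i + 1) \o dsum_fst (Y (i + 1)) (X i))%VF
    ((b i \o dsum_snd (Y (i + 1)) (X i)) + (s i \o dsum_fst (Y (i + 1)) (X i)))%VF.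
have mE i v : m i v = (a (i + 1) v.1, b i v.2 + s i v.1).
  by rewrite dsum_pairE add_lfunE !comp_lfunE !dsum_fstE dsum_sndE.
have mh i : m i \in modhom (cone f i) (cone u i).
  apply: dsum_pair_hom; first exact: modhom_comp (cmor_hom _ _) (dsum_fst_hom _ _).
  apply: rpredD; first exact: modhom_comp (cmor_hom _ _) (dsum_snd_hom _ _).
  exact: modhom_comp (sh _) (dsum_fst_hom _ _).
have bfE i y : b (i + 1) (f (i + 1) y) = u (i + 1) (a (i + 1) y) +
    (diff B i (s i y) + s (i + 1) (diff Y (i + 1) y)).
  by have := sE i y; rewrite !ccompE.
have md i : (diff (cone u) i \o m i)%VF = (m (i + 1) \o diff (cone f) i)%VF.
  apply/lfunP => v; rewrite !comp_lfunE [m i v]mE !coneE [RHS]mE /=.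
  congr pair; first by rewrite linearN /= cmor_diffE.
  rewrite !linearD linearN /= bfE cmor_diffE.
  by rewrite [RHS]addrAC !addrA addrK [LHS]addrAC.
exists (CMap mh md); split.
  (* Correcting the cocycle [(y, x)] by the boundary of [(y', 0)] makes its first
     component zero. *)
  move=> i [y x] [al be]; rewrite !coneE /= mE /= => -[/eqP].
  rewrite oppr_eq0 => /eqP dy dx [ay bx].
  have [|y' yE] := ai _ y (- al) dy; first by rewrite linearN.
  pose x' := x + f (i + 1) y'.
  have dx' : diff X (i + 1) x' = 0.
    by rewrite linearD /= cmor_diffE -yE [LHS]addrC dx.
  pose al' := al + a (i + 1) y'; pose be' := be + s i y'.
  have dal' : diff A (i + 1) al' = 0.
    by rewrite linearD /= cmor_diffE -yE ay addrN.
  have bx' : b (i + 1) x' = u (i + 1) al' + diff B i be'.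
    rewrite !linearD /= bfE -yE addrACA -bx.
    by rewrite -[RHS]addrA [in RHS](addrC (s _ _)) !addrA.
  clearbody al' be'.
  have [y1 [al2 [dy1 al'E]]] := asurj _ al' dal'.
  have [||x2 x2E] := bi i (x' - f (i + 1) y1) (u i al2 - s i y1 + be').
  - by rewrite linearB /= dx' cmor_diffE dy1 linear0 subr0.
  - rewrite linearB /= bx' bfE al'E dy1 linear0 addr0.
    rewrite [u _ (_ + _)]linearD [diff B _ (_ + _)]linearD /=.
    rewrite [diff B _ (_ - _)]linearB /= cmor_diffE.
    rewrite -[X in X - _]addrA opprD addrACA subrr add0r.
    by rewrite [RHS]addrAC.
  exists (y1 - y', x2); rewrite coneE /=; congr pair.
    by rewrite linearB /= dy1 sub0r opprK.
  by rewrite linearB /= -x2E /x' [RHS]addrC [RHS]addrA subrK addrK.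
(* Up to the boundary of [(al', 0)], the first component [al] is [a y]. *)
move=> i [al be]; rewrite coneE /= => -[/eqP].
rewrite oppr_eq0 => /eqP dal dbe.
have [y [al' [dy alE]]] := asurj _ al dal.
pose be' := be + u (i + 1) al'.
have dbe' : diff B (i + 1) be' = - u (i + 1 + 1) (a (i + 1 + 1) y).
  apply/eqP; rewrite -addr_eq0; apply/eqP.
  rewrite linearD /= cmor_diffE -[LHS]addrA -linearD /=.
  by rewrite [_ + a _ _]addrC -alE [LHS]addrC dbe.
have [||x xE] := bi _ (f (i + 1 + 1) y) (s (i + 1) y - be').
- by rewrite cmor_diffE dy linear0.
- by rewrite bfE dy linear0 addr0 linearB /= dbe' opprK [LHS]addrC.
have [|x1 [be1 [dx1 be1E]]] := bsurj _ (be' + b (i + 1) x - s (i + 1) y).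
  rewrite linearB linearD /= dbe' cmor_diffE -xE bfE dy linear0 addr0.
  by rewrite [_ + (_ + _)]addrA addNr add0r subrr.
exists (y, x1 - x), (- al', be1); rewrite !coneE /= mE /=; split; congr pair.
- by rewrite dy oppr0.
- by rewrite linearB /= dx1 sub0r xE subrr.
- by rewrite linearN opprK.
apply: (addIr (u (i + 1) al')).
rewrite [u _ (- _)]linearN [b _ (_ - _)]linearB /=.
move/eqP: be1E; rewrite -subr_eq => /eqP <-.
rewrite -[RHS]addrA [- u _ _ + _]addrC subrK [RHS]addrAC.
by rewrite [X in X + s _ _]addrAC subrK [RHS]addrAC subrK addrK.
Qed.
End Square.

(** * Inflations of two-term complexes *)

Section Inflation.
Variables (F : fieldType) (L : falgType F).

Lemma dsum_projective (P Q : fdmod L) :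
  projective P -> projective Q -> projective (dsum P Q).
Proof.
move=> Pproj Qproj M N g h gh hh gsurj.
pose iP := dsum_pair \1%VF (0 : 'Hom(P, Q)).
pose iQ := dsum_pair (0 : 'Hom(Q, P)) \1%VF.
have iPh : iP \in modhom P (dsum P Q) by rewrite dsum_pair_hom ?modhom_id ?mem0v.
have iQh : iQ \in modhom Q (dsum P Q) by rewrite dsum_pair_hom ?modhom_id ?mem0v.
have [k1 k1h k1E] := Pproj _ _ _ _ gh (modhom_comp hh iPh) gsurj.
have [k2 k2h k2E] := Qproj _ _ _ _ gh (modhom_comp hh iQh) gsurj.
exists ((k1 \o dsum_fst P Q) + (k2 \o dsum_snd P Q))%VF.
  by rewrite rpredD ?modhom_comp ?dsum_fst_hom ?dsum_snd_hom.
rewrite comp_lfunDr !comp_lfunA k1E k2E; apply/lfunP => v.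
rewrite add_lfunE !comp_lfunE dsum_fstE dsum_sndE !dsum_pairE !lfunE -linearD /=.
by congr (h _); case: v => a b; congr pair; rewrite /= ?addr0 ?add0r.
Qed.

(** The cone of [f] is isomorphic to the two-term complex [Z], so the identity of
    the cone is homotopic to a map through [Z].  In degree -2 both [Z] and the
    contribution of degree -3 of the cone vanish, and the homotopy identity reads
    as a left inverse of the differential. *)
Lemma inflation_retraction (Y X : two_term L) (f : cmap Y X) :
  inflation f ->
  exists2 r : 'Hom(cone f (-2 + 1), cone f (-2)),
    r \in modhom (cone f (-2 + 1)) (cone f (-2)) &
    forall v, r (diff (cone f) (-2) v) = v.
Proof.
move=> [Z [_ [_ [A [B [u [a [b [c [[ia ib ic] [sq _ _]]]]]]]]]]].
have [a' [b' [qa qb ba]]] :=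
  commutes_lift (@two_proj _ _ Y) (@two_proj _ _ X) ia ib sq.
have [m qm] := cone_map_qis qa qb ba.
have Cproj i : projective (cone f i) by apply: dsum_projective; apply: two_proj.
have [s qs _] := section_qis (@two_proj _ _ Z) (back_qis c).
pose c' := ccomp (fwd c) s.
have qc : qis c' := qis_comp (is_iso_qis ic) qs.
have [rho rhoE] := lift_qis m Cproj qc.
have [tau tauE] := lift_qis c' (@two_proj _ _ Z) qm.
(* [m tau rho], [c' rho] and [m] are homotopic, and [m] can be cancelled. *)
have /homotopicE[t th tE] : homotopic (ccomp tau rho) (Defs.cid (cone f)).
  apply: (homotopic_cancel_qis Cproj qm).
  by rewrite ccompA tauE rhoE ccomp_idr; reflexivity.
(* Homotopies are indexed by [i + 1], so degree -2 is reached from [i = -3]. *)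
exists (- t (-3 + 1)) => [|v]; first by rewrite memvN; apply: th.
have := tE (-3) v; rewrite ccompE id_lfunE.
have -> : rho (-3 + 1) v = 0 by apply: (@two_conc _ _ Z).
have -> : t (-3) v = 0.
  rewrite [LHS]surjective_pairing; congr pair.
    exact: (@two_conc _ _ Y).
  exact: (@two_conc _ _ X).
rewrite !linear0 add0r opp_lfunE => /eqP; rewrite eq_sym addr_eq0 => /eqP vE.
by rewrite {2}vE.
Qed.

(** The retraction [r1] extends [psi] to [psi r1] on [Y^0 (+) X^-1].  Its
    restriction to [X^-1] factors as [chi x] by semistability, and
    [chi x f^-1 = chi f^0 y]; its restriction to [Y^0] enters with a minus sign
    because the differential of the cone is [(y, 0) |-> (- d y, f y)]. *)
Lemma inflation_precomp_surj (Y X : two_term L) (f : cmap Y X) (M : fdmod L) :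
  inflation f -> semistable X M ->
  forall psi : 'Hom(Y (-1), M), psi \in modhom (Y (-1)) M ->
  exists2 phi : 'Hom(Y 0, M), phi \in modhom (Y 0) M &
    (phi \o (diff Y (-1) : 'Hom(Y (-1), Y 0)))%VF = psi.
Proof.
move=> /inflation_retraction[r rh rE] Xss psi psih.
pose iY : 'Hom(Y 0, cone f (-2 + 1)) := dsum_pair \1%VF (0 : 'Hom(Y 0, X (-1))).
pose iX : 'Hom(X (-1), cone f (-2 + 1)) :=
  dsum_pair (0 : 'Hom(X (-1), Y 0)) \1%VF.
have iYh : iY \in modhom (Y 0) (cone f (-2 + 1)).
  by apply: dsum_pair_hom; [apply: modhom_id | apply: mem0v].
have iXh : iX \in modhom (X (-1)) (cone f (-2 + 1)).
  by apply: dsum_pair_hom; [apply: mem0v | apply: modhom_id].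
pose r1 : 'Hom(cone f (-2 + 1), Y (-1)) := (dsum_fst (Y (-1)) (X (-2)) \o r)%VF.
have r1h : r1 \in modhom (cone f (-2 + 1)) (Y (-1)).
  exact: modhom_comp (dsum_fst_hom _ _) rh.
have [chi [[chih chiE] _]] := Xss _ (modhom_comp psih (modhom_comp r1h iXh)).
exists ((chi \o (f 0 : 'Hom(Y 0, X 0))) - (psi \o (r1 \o iY)))%VF.
  apply: rpredB; last by do 2!apply: modhom_comp => //.
  exact: modhom_comp chih (cmor_hom f 0).
apply/lfunP => y.
have yE : y = r1 (iX (f (-1) y) - iY (diff Y (-1) y)).
  rewrite comp_lfunE dsum_fstE.
  have -> : iX (f (-1) y) - iY (diff Y (-1) y) = diff (cone f) (-2) (y, 0).
    rewrite coneE !dsum_pairE !lfunE /= linear0 addr0.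
    by congr pair; rewrite /= ?add0r ?subr0.
  by rewrite rE.
have chiy : psi (r1 (iX (f (-1) y))) = chi (f 0 (diff Y (-1) y)).
  have /lfunP/(_ (f (-1) y)) := chiE; rewrite !comp_lfunE => <-.
  by rewrite cmor_diffE.
rewrite comp_lfunE add_lfunE opp_lfunE !comp_lfunE -[_ (r _)]comp_lfunE.
by rewrite [in RHS]yE [r1 _]linearB [psi (_ - _)]linearB /= chiy.
Qed.

Lemma dim_modhom_surj (P Q M : fdmod L) (g : 'Hom(P, Q)) :
  (forall psi, psi \in modhom P M ->
     exists2 phi, phi \in modhom Q M & (phi \o g)%VF = psi) ->
  (\dim (modhom P M) <= \dim (modhom Q M))%N.
Proof.
move=> gsurj; pose T := linfun (@precomp _ _ P Q M g).
rewrite -(limg_ker_dim T (modhom Q M)) -[X in (X <= _)%N]add0n leq_add //.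
apply: dimvS; apply/subvP => psi /gsurj[phi phih <-].
by apply/memv_imgP; exists phi; rewrite ?lfunE.
Qed.

Lemma dim_modhom_bij (P Q M : fdmod L) (g : 'Hom(P, Q)) :
  g \in modhom P Q ->
  (forall psi, psi \in modhom P M ->
     exists! phi, phi \in modhom Q M /\ (phi \o g)%VF = psi) ->
  \dim (modhom Q M) = \dim (modhom P M).
Proof.
move=> gh gbij; pose T := linfun (@precomp _ _ P Q M g).
apply/eqP; rewrite eqn_leq; apply/andP; split; last first.
  by apply: (@dim_modhom_surj _ _ _ g) => psi /gbij[phi [[phih phiE] _]]; exists phi.
have kerT : (modhom Q M :&: lker T)%VS = 0%VS.
  apply/eqP; rewrite -subv0; apply/subvP => h; rewrite memv_cap memv0 memv_ker.
  move=> /andP[hh]; rewrite lfunE /= => /eqP hg.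
  have [phi [_ uniq]] := gbij 0 (mem0v _).
  rewrite -(uniq h) // -(uniq 0) //; split; rewrite ?mem0v ?comp_lfun0l //.
rewrite -(limg_dim_eq kerT); apply: dimvS; apply/subvP => _ /memv_imgP[h hh ->].
by rewrite lfunE; apply: modhom_comp hh gh.
Qed.

Lemma euler_class_two (X : two_term L) (M : fdmod L) :
  euler (class_two X) (class_mod M) =
  (\dim (modhom (X 0) M))%:Z - (\dim (modhom (X (-1)) M))%:Z.
Proof. by rewrite eulerBl !eulerE. Qed.

End Inflation.
Unset Implicit Arguments.

Theorem theorem4p16 (R : realType) (L : falgType R[i])
    (L_bound_quiver : bound_quiver_algebra L)
    (X : two_term L) (M : fdmod L) :
  semistable X M -> numerically_semistable X (class_mod M).
Proof.
move=> Xss; split=> [|Y f finfl]; rewrite euler_class_two.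
  by apply/eqP; rewrite subr_eq0 (dim_modhom_bij (diff_hom X (-1)) Xss).
rewrite Num.Theory.subr_ge0 lez_nat.
exact: dim_modhom_surj (inflation_precomp_surj finfl Xss).
Qed.
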